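(* Let $\mathcal{A} \subseteq \mathcal{F}$ be a field of subsets of $\mathbb{N}$. The following statements are logically equivalent. 1. There is a chain $\mathcal{T} \subseteq \mathcal{A}$ such that $[\mathcal{A}] = \sigma[\alpha(\mathcal{T})]$. 2. There is a countable set $\mathcal{C} \subseteq \mathcal{A}$ such that $[\mathcal{A}] = \sigma[\alpha(\mathcal{C})]$. Moreover, if either statement holds then $\mathcal{A}$ is separable.
   Context: $\mathbb{N} = \{1,2,3,\ldots\}$. $\mathcal{F}$ is the collection of all $A\subseteq\mathbb{N}$ for which $\nu(A) := \lim_{N\to\infty}\frac1N\sum_{n=1}^N I_A(n)$ exists ($I_A$ the indicator function), and $\mathcal{N} := \{A\in\mathcal{F}:\nu(A)=0\}$, an ideal of $\mathcal{P}(\mathbb{N})$. $[A]$ is the class of $A$ in the Boolean quotient $\mathcal{P}(\mathbb{N})/\mathcal{N}$ (under $A\sim B\iff A\triangle B\in\mathcal{N}$), and $[\mathcal{C}] := \{[A]:A\in\mathcal{C}\}$ for $\mathcal{C}\subseteq\mathcal{P}(\mathbb{N})$. A chain is a collection of sets totally ordered by inclusion. $\alpha(\mathcal{C})$ is the smallest field of subsets of $\mathbb{N}$ containing $\mathcal{C}$. A subset $\mathcal{M}$ of a Boolean algebra $\mathcal{B}$ is a monotone class if every non-decreasing sequence in $\mathcal{M}$ has an upper bound belonging to $\mathcal{M}$ that is a least upper bound in $\mathcal{B}$, and every non-increasing sequence in $\mathcal{M}$ has a lower bound belonging to $\mathcal{M}$ that is a greatest lower bound in $\mathcal{B}$. $[\mathcal{F}]$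 is a monotone class in $\mathcal{P}(\mathbb{N})/\mathcal{N}$. For a field $\mathcal{B}\subseteq\mathcal{F}$, $\sigma[\mathcal{B}]$ is the smallest monotone class in $\mathcal{P}(\mathbb{N})/\mathcal{N}$ containing $[\mathcal{B}]$; equivalently, the smallest subalgebra containing $[\mathcal{B}]$ and containing suprema (taken in $\mathcal{P}(\mathbb{N})/\mathcal{N}$) of all its countable subsets. $\mathcal{A}$ is separable if there is a countable $\mathcal{D}\subseteq\mathcal{A}$ such that for every $A\in\mathcal{A}$ and $\epsilon>0$ there is $A_\epsilon\in\mathcal{D}$ with $\nu(A\triangle A_\epsilon)<\epsilon$. *)

(* Defs.v *)
From HB Require Import structures.
From mathcomp Require Import all_boot all_order all_algebra.
From mathcomp Require Import all_classical all_reals all_analysis.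

Set Implicit Arguments.
Unset Strict Implicit.
Unset Printing Implicit Defensive.

Import Order.TTheory GRing.Theory Num.Theory.
Import numFieldNormedType.Exports.

Local Open Scope classical_set_scope.
Local Open Scope ring_scope.

Definition posnat := {n : nat | (0 < n)%N}.

Definition set_field (T : Type) (G : set (set T)) :=
  [/\ G setT, setC_closed G & setU_closed G].

Definition field_gen (T : Type) (C : set (set T)) : set (set T) :=
  smallest (@set_field T) C.

Definition set_chain (T : Type) (C : set (set T)) := total_on C subset.

Section density.
Variable R : realType.
Implicit Types (A B : set posnat) (C : set (set posnat)) (N : nat).

(* [sval @` A] is A viewed as a set of natural numbers, so that the sum ranges
   over 1, ..., N. The value at N = 0 is irrelevant for the limit. *)
Definition freq A N : R := N%:R^-1 * \sum_(1 <= n < N.+1) \1_(sval @` A) n.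

Definition has_density : set (set posnat) := [set A | cvg (freq A @ \oo)].

(* Only meaningful on [has_density]. *)
Definition nu A : R := lim (freq A @ \oo).

Definition nu_null : set (set posnat) :=
  [set A | has_density A /\ nu A = 0].

Definition nu_separable C := exists D : set (set posnat),
  [/\ D `<=` C, countable D &
      forall A (e : R), C A -> 0 < e ->
        exists2 B, D B & nu (A `+` B) < e].

Lemma nu_nullP A : nu_null A <-> freq A @ \oo --> (0 : R).
Proof.
split=> [[cA <-]//|A0].
by split; [apply/cvg_ex; exists 0|exact/cvg_lim].
Qed.

Lemma freq_ge0 A N : 0 <= freq A N.
Proof. by rewrite mulr_ge0 ?invr_ge0// sumr_ge0// => n _; rewrite indicE ler0n. Qed.

Lemma freq_subset A B N : A `<=` B -> freq A N <= freq B N.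
Proof.
move=> AB; rewrite ler_wpM2l ?invr_ge0//; apply: ler_sum => n _.
rewrite !indicE ler_nat.
case: (boolP (n \in _)) => //= /set_mem[x Ax xn].
by rewrite mem_set//; exists x => //; exact: AB.
Qed.

Lemma freqU A B N : freq (A `|` B) N <= freq A N + freq B N.
Proof.
rewrite -mulrDr ler_wpM2l ?invr_ge0// -big_split/=; apply: ler_sum => n _.
rewrite !indicE -natrD ler_nat.
case: (boolP (n \in sval @` (A `|` B))) => //= /set_mem[x [Ax|Bx] xn].
  by rewrite (@mem_set _ (sval @` A))//; exists x.
by rewrite addnC (@mem_set _ (sval @` B))//; exists x.
Qed.

Lemma nu_null_sub A B : A `<=` B -> nu_null B -> nu_null A.
Proof.
move=> AB /nu_nullP B0; apply/nu_nullP.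
apply: (@squeeze_cvgr _ _ _ _ (fun=> 0) (freq B)) => //; last exact: cvg_cst.
by apply: nearW => N; rewrite freq_ge0 freq_subset.
Qed.

Lemma nu_nullU A B : nu_null A -> nu_null B -> nu_null (A `|` B).
Proof.
move=> /nu_nullP A0 /nu_nullP B0; apply/nu_nullP.
apply: (@squeeze_cvgr _ _ _ _ (fun=> 0) (freq A \+ freq B)).
- by apply: nearW => N; rewrite freq_ge0 freqU.
- exact: cvg_cst.
- by rewrite -[X in _ --> X]addr0; exact: cvgD.
Qed.

Lemma nu_null0 : nu_null set0.
Proof.
apply/nu_nullP; rewrite (_ : freq set0 = fun=> 0); first exact: cvg_cst.
apply/funext => N; rewrite /freq big1 ?mulr0// => n _.
by rewrite indicE image_set0 in_set0.
Qed.

Definition null_eq A B := `[< nu_null (A `+` B) >].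

Lemma null_eq_refl : reflexive null_eq.
Proof. by move=> A; apply/asboolP; rewrite setYK; exact: nu_null0. Qed.

Lemma null_eq_sym : symmetric null_eq.
Proof. by move=> A B; rewrite /null_eq setYC. Qed.

Lemma null_eq_trans : transitive null_eq.
Proof.
move=> B A D /asboolP AB /asboolP BD; apply/asboolP.
apply: nu_null_sub (nu_nullU AB BD) => x /=; have := EM (B x); tauto.
Qed.

Canonical null_equiv := EquivRel null_eq null_eq_refl null_eq_sym null_eq_trans.

Definition posnat_mod_null := {eq_quot null_equiv}%qT.

HB.instance Definition _ := Choice.on posnat_mod_null.
HB.instance Definition _ := EqQuotient.on posnat_mod_null.

Definition cls A : posnat_mod_null := \pi_posnat_mod_null%qT A.

Definition clss C : set posnat_mod_null := cls @` C.

Implicit Types x y z : posnat_mod_null.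

Lemma clsP A B : cls A = cls B <-> nu_null (A `+` B).
Proof.
by split=> [/eqmodP/asboolP//|AB]; apply/eqmodP/asboolP.
Qed.

Lemma clsK x : cls (repr x) = x. Proof. exact: reprK. Qed.

Definition qmeet x y := cls (repr x `&` repr y).
Definition qjoin x y := cls (repr x `|` repr y).
Definition qcompl x := cls (~` repr x).
Definition qle x y := qmeet x y == x.
Definition qlt x y := (y != x) && qle x y.

Lemma repr_cls A : nu_null (repr (cls A) `+` A).
Proof. by apply/clsP; rewrite clsK. Qed.

Lemma qmeetE A B : qmeet (cls A) (cls B) = cls (A `&` B).
Proof.
apply/clsP; apply: nu_null_sub (nu_nullU (repr_cls A) (repr_cls B)) => n /=.
have := EM (A n); have := EM (B n).
have := EM (repr (cls A) n); have := EM (repr (cls B) n); tauto.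
Qed.

Lemma qjoinE A B : qjoin (cls A) (cls B) = cls (A `|` B).
Proof.
apply/clsP; apply: nu_null_sub (nu_nullU (repr_cls A) (repr_cls B)) => n /=.
have := EM (A n); have := EM (B n).
have := EM (repr (cls A) n); have := EM (repr (cls B) n); tauto.
Qed.

Lemma qcomplE A : qcompl (cls A) = cls (~` A).
Proof.
apply/clsP; apply: nu_null_sub (repr_cls A) => n /=.
have := EM (A n); have := EM (repr (cls A) n); tauto.
Qed.

Lemma qmeetC : commutative qmeet.
Proof. by move=> x y; rewrite /qmeet setIC. Qed.

Lemma qjoinC : commutative qjoin.
Proof. by move=> x y; rewrite /qjoin setUC. Qed.

Lemma qmeetA : associative qmeet.
Proof.
move=> x y z; rewrite -(clsK x) -(clsK y) -(clsK z).
by rewrite !qmeetE setIA.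
Qed.

Lemma qjoinA : associative qjoin.
Proof.
move=> x y z; rewrite -(clsK x) -(clsK y) -(clsK z).
by rewrite !qjoinE setUA.
Qed.

Lemma qjoinKI y x : qmeet x (qjoin x y) = x.
Proof. by rewrite -(clsK x) -(clsK y) qjoinE qmeetE setUC setKU. Qed.

Lemma qmeetKU y x : qjoin x (qmeet x y) = x.
Proof. by rewrite -(clsK x) -(clsK y) qmeetE qjoinE setIC setKI. Qed.

Lemma qmeetUl : left_distributive qmeet qjoin.
Proof.
move=> x y z; rewrite -(clsK x) -(clsK y) -(clsK z).
by rewrite !(qmeetE, qjoinE) setIUl.
Qed.

Lemma qmeetxx : idempotent_op qmeet.
Proof. by move=> x; rewrite /qmeet setIid clsK. Qed.

Fact density_display : Order.disp_t. Proof. exact: Order.Disp tt tt. Qed.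

HB.instance Definition _ :=
  Order.isMeetJoinDistrLattice.Build density_display posnat_mod_null
    (fun _ _ => erefl) (fun _ _ => erefl) qmeetC qjoinC qmeetA qjoinA
    qjoinKI qmeetKU qmeetUl qmeetxx.

Lemma cls0x x : (cls set0 <= x)%O.
Proof. by apply/eqP; rewrite -(clsK x) qmeetE set0I. Qed.

Lemma clsx1 x : (x <= cls setT)%O.
Proof. by apply/eqP; rewrite -(clsK x) qmeetE setIT. Qed.

HB.instance Definition _ :=
  Order.hasBottom.Build density_display posnat_mod_null cls0x.
HB.instance Definition _ :=
  Order.hasTop.Build density_display posnat_mod_null clsx1.

Lemma qjoinxC x : qjoin x (qcompl x) = cls setT.
Proof. by rewrite -(clsK x) qcomplE qjoinE setUv. Qed.

Lemma qmeetxC x : qmeet x (qcompl x) = cls set0.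
Proof. by rewrite -(clsK x) qcomplE qmeetE setICr. Qed.

HB.instance Definition _ :=
  Order.TBDistrLattice_hasComplement.Build density_display posnat_mod_null
    qjoinxC qmeetxC.

Lemma cls_le A B : (cls A <= cls B)%O <-> nu_null (A `\` B).
Proof.
have -> : (cls A <= cls B)%O <-> cls (A `&` B) = cls A.
  by rewrite -qmeetE; split=> /eqP.
rewrite clsP; suff -> : (A `&` B) `+` A = A `\` B by [].
by apply/seteqP; split => n /=; have := EM (B n); tauto.
Qed.

End density.

Arguments clss R C : clear implicits.

Definition monotone_class d (B : ctbDistrLatticeType d) (M : set B) :=
  (forall u : nat -> B, (forall n, M (u n)) -> nondecreasing_seq u ->
     exists2 x, M x & supremums (range u) x) /\
  (forall u : nat -> B, (forall n, M (u n)) -> nonincreasing_seq u ->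
     exists2 x, M x & infimums (range u) x).

(* [smallest] is an intersection, and is itself a monotone class as soon as some
   monotone class contains [clss R B]: a limit of a monotone sequence is unique
   in the quotient. For B included in [has_density R], [clss R (has_density R)]
   is such a class. *)
Definition sigma_cls (R : realType) (B : set (set posnat)) :
    set (posnat_mod_null R) :=
  smallest (@monotone_class _ (posnat_mod_null R)) (clss R B).

Arguments sigma_cls R B : clear implicits.

(* Main.v *)
Require Import Defs.
From mathcomp Require Import all_boot all_order all_algebra.
From mathcomp Require Import all_classical all_reals all_analysis.
From mathcomp Require Import lra zify.

Set Implicit Arguments.
Unset Strict Implicit.
Unset Printing Implicit Defensive.

Import Order.Theory GRing.Theory Num.Theory.
Import numFieldNormedType.Exports.

Local Open Scope classical_set_scope.
Local Open Scope ring_scope.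

(** From a countable set of generators to a chain, no limit is needed: the field
    generated by countably many sets c 0, c 1, ... is already generated by a
    chain [lex_set_chain, field_gen_lex_set]. The points are ordered
    lexicographically by their itinerary (x \in c 0, x \in c 1, ...), and the
    upper sections cut out by finite words are nested, are finite Boolean
    combinations of the c n, and give back each c n.

    From a chain T to a countable set, choose a countable C in T such that nu
    maps C to a dense subset of the image of T. A set t of T is comparable with
    every element of C, so either elements of C below t or elements of C above t
    approximate t in density. This makes the class of t the supremum or the
    infimum of a monotone sequence of classes of the field generated by C
    [sigma_cls_of_subsets]. Since the monotone class generated by a field is a
    subalgebra [sigma_cls_field], it then contains the classes of the whole field
    generated by T [chain_sigma_cls].

    For separability, the sets of A that a generating field approximates in
    density form a monotone class modulo null sets, hence exhaust A
    [sigma_cls_dense]; and a field with countably many generators is countable.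

    Both limit arguments rest on one fact on densities: a non-decreasing
    sequence of sets with density has a supremum modulo null sets, this supremum
    has a density, and nu is continuous along the sequence [has_density_sup].
    The supremum is a diagonal union, which takes in the successive sets late
    enough for their frequencies to stay close to their densities
    [density_diagonal]. *)

(** * Fields of sets and the chains that generate them *)

Lemma field_gen_field T (C : set (set T)) : set_field (field_gen C).
Proof.
split.
- by move=> G [[GT _ _] _].
- by move=> X genX G [Gf CG]; have [_ GC _] := Gf; apply: GC; exact: genX.
- move=> X Y genX genY G [Gf CG]; have [_ _ GU] := Gf.
  by apply: GU; [exact: genX|exact: genY].
Qed.

Lemma set_field0 T (G : set (set T)) : set_field G -> G set0.
Proof. by move=> [GT GC _]; rewrite -setCT; exact: GC. Qed.

Lemma set_fieldI T (G : set (set T)) (X Y : set T) :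
  set_field G -> G X -> G Y -> G (X `&` Y).
Proof.
move=> [_ GC GU] GX GY; rewrite -(setCK (X `&` Y)) setCI.
by apply/GC/GU; exact: GC.
Qed.

Lemma set_fieldD T (G : set (set T)) (X Y : set T) :
  set_field G -> G X -> G Y -> G (X `\` Y).
Proof.
move=> Gf GX GY; have [_ GC _] := Gf.
by rewrite setDE; apply: set_fieldI => //; exact: GC.
Qed.

Lemma set_fieldY T (G : set (set T)) (X Y : set T) :
  set_field G -> G X -> G Y -> G (X `+` Y).
Proof.
by move=> Gf GX GY; have [_ _ GU] := Gf; apply: GU; exact: set_fieldD.
Qed.

Lemma field_gen_sub T (C G : set (set T)) :
  set_field G -> C `<=` G -> field_gen C `<=` G.
Proof. exact: smallest_sub. Qed.

Lemma field_genP T (C D : set (set T)) :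
  C `<=` field_gen D -> D `<=` field_gen C -> field_gen C = field_gen D.
Proof.
by move=> CD DC; apply/seteqP; split; apply: field_gen_sub => //;
  exact: field_gen_field.
Qed.

(** Trees are names for the elements of a generated field; as there are only
    countably many names, the field is countable. *)
Fixpoint tree_set T (c : nat -> set T) (t : GenTree.tree nat) : set T :=
  match t with
  | GenTree.Leaf n => c n
  | GenTree.Node 1 [:: t1] => ~` tree_set c t1
  | GenTree.Node 2 [:: t1; t2] => tree_set c t1 `|` tree_set c t2
  | _ => setT
  end.

Lemma countable_field_gen T (C : set (set T)) :
  countable C -> countable (field_gen C).
Proof.
move=> Ccnt; have [c Cc] : exists c : nat -> set T, C `<=` range c.
  move: Ccnt => /pfcard_geP[->|[f]]; first by exists (fun=> set0).
  by exists f; rewrite image_eq.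
apply: (@sub_countable _ _ _ [set: GenTree.tree nat]); last exact: countableP.
apply: card_le_trans (card_image_le (tree_set c) setT).
apply: subset_card_le; apply: field_gen_sub => [|X /Cc[n _ <-]]; last first.
  by exists (GenTree.Leaf n).
split.
- by exists (GenTree.Node 0 [::]).
- by move=> _ [t _ <-]; exists (GenTree.Node 1 [:: t]).
- by move=> _ _ [s _ <-] [t _ <-]; exists (GenTree.Node 2 [:: s; t]).
Qed.

(** The points whose itinerary (x \in c 0, x \in c 1, ...) is at least w in the
    lexicographic order. *)
Fixpoint lex_set T (c : nat -> set T) (w : seq bool) : set T :=
  if w is b :: w' then
    if b then c 0%N `&` lex_set (c \o S) w' else c 0%N `|` lex_set (c \o S) w'
  else setT.

Lemma lex_set_chain T (c : nat -> set T) : set_chain (range (lex_set c)).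
Proof.
move=> _ _ [v _ <-] [w _ <-]; elim: v c w => [|a v IH] c [|b w] /=.
- by left.
- by right.
- by left.
have [vw|wv] := IH (c \o S) w; case: a; case: b.
- by left; exact: setIS.
- by left => x [cx _]; left.
- by right => x [cx _]; left.
- by left; exact: setUS.
- by right; exact: setIS.
- by left => x [cx _]; left.
- by right => x [cx _]; left.
- by right; exact: setUS.
Qed.

Lemma lex_set_field T (G : set (set T)) (c : nat -> set T) (w : seq bool) :
  set_field G -> (forall n, G (c n)) -> G (lex_set c w).
Proof.
move=> Gf; have [GT _ GU] := Gf.
elim: w c => [|[] w IH] c Gc //=; [apply: set_fieldI|apply: GU] => //;
  by apply: IH => n; exact: Gc.
Qed.

(** The first set of the sequence is the lex_set of the word true; every
    lex_set X of the shifted sequence is recovered from it and the two sets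
    c 0 `&` X and c 0 `|` X, which induction on n exploits. *)
Lemma field_gen_lex_set T (c : nat -> set T) n :
  field_gen (range (lex_set c)) (c n).
Proof.
elim: n c => [|n IH] c.
  by apply: sub_gen_smallest; exists [:: true] => //=; rewrite setIT.
have genf := field_gen_field (range (lex_set c)); have [_ _ genU] := genf.
have genL w : field_gen (range (lex_set c)) (lex_set c w).
  by apply: sub_gen_smallest; exists w.
suff shifted : range (lex_set (c \o S)) `<=` field_gen (range (lex_set c)).
  exact: field_gen_sub genf shifted _ (IH (c \o S)).
move=> _ [w _ <-]; set X := lex_set _ w.
have -> : X = (c 0%N `&` X) `|` ((c 0%N `|` X) `\` c 0%N).
  apply/seteqP; split=> x /=; last by tauto.
  by have := EM (c 0%N x); tauto.
refine (genU _ _ (genL (true :: w)) _).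
apply: set_fieldD genf _ _; first exact: (genL (false :: w)).
by have := genL [:: true]; rewrite /= setIT.
Qed.

Lemma countable_field_chain T (C : set (set T)) : countable C ->
  exists2 L : set (set T), set_chain L & field_gen L = field_gen C.
Proof.
move=> /pfcard_geP[->|[f]]; first by exists set0.
have [c {f}<-] : exists c : nat -> set T, range c = C.
  by exists f; exact: image_eq.
exists (range (lex_set c)); first exact: lex_set_chain.
apply: field_genP => _ [i _ <-]; last exact: field_gen_lex_set.
apply: lex_set_field => [|n]; first exact: field_gen_field.
by apply: sub_gen_smallest; exists n.
Qed.

(** * Monotone classes in a Boolean algebra *)

Lemma supremums_seqP d (B : porderType d) (u : nat -> B) (x : B) :
  supremums (range u) x <->
  (forall n, u n <= x)%O /\ (forall y, (forall n, u n <= y)%O -> (x <= y)%O).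
Proof.
split=> [[ux xlub]|[ux xlub]]; split.
- by move=> n; apply: ux; exists n.
- by move=> y uy; apply: xlub => _ [n _ <-].
- by move=> _ [n _ <-].
- by move=> y uy; apply: xlub => n; apply: uy; exists n.
Qed.

Lemma infimums_seqP d (B : porderType d) (u : nat -> B) (x : B) :
  infimums (range u) x <->
  (forall n, x <= u n)%O /\ (forall y, (forall n, y <= u n)%O -> (y <= x)%O).
Proof.
split=> [[ux xglb]|[ux xglb]]; split.
- by move=> n; apply: ux; exists n.
- by move=> y uy; apply: xglb => _ [n _ <-].
- by move=> _ [n _ <-].
- by move=> y uy; apply: xglb => n; apply: uy; exists n.
Qed.

Lemma sup_compl d (B : ctbDistrLatticeType d) (u : nat -> B) (x : B) :
  supremums (range u) x <-> infimums (range (fun n => ~` u n)%O) (~` x)%O.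
Proof.
rewrite supremums_seqP infimums_seqP; split=> -[ux lub]; split.
- by move=> n; rewrite leC.
- by move=> y uy; rewrite lexC; apply: lub => n; rewrite lexC.
- by move=> n; rewrite -leC.
- by move=> y uy; rewrite -leC; apply: lub => n; rewrite leC.
Qed.

Lemma inf_compl d (B : ctbDistrLatticeType d) (u : nat -> B) (x : B) :
  infimums (range u) x <-> supremums (range (fun n => ~` u n)%O) (~` x)%O.
Proof.
rewrite sup_compl complK.
by under [X in _ <-> infimums X _]eq_imagel do rewrite complK.
Qed.

Lemma nonincreasing_compl d (B : ctbDistrLatticeType d) (u : nat -> B) :
  nondecreasing_seq u -> nonincreasing_seq (fun n => ~` u n)%O.
Proof. by move=> und m n mn; rewrite leC und. Qed.

Lemma nondecreasing_compl d (B : ctbDistrLatticeType d) (u : nat -> B) :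
  nonincreasing_seq u -> nondecreasing_seq (fun n => ~` u n)%O.
Proof. by move=> uni m n mn; rewrite leC uni. Qed.

Lemma sup_joinr d (B : ctbDistrLatticeType d) (u : nat -> B) (x y : B) :
  supremums (range u) x ->
  supremums (range (fun n => u n `|` y)%O) (x `|` y)%O.
Proof.
rewrite !supremums_seqP => -[ux lub]; split=> [n|z uz]; first exact: leU2.
rewrite leUx; apply/andP; split; last exact: le_trans (leUr _ _) (uz 0%N).
by apply: lub => n; apply: le_trans (uz n); exact: leUl.
Qed.

(** Joining with y commutes with infima because z <= u `|` y means
    z `\` y <= u. *)
Lemma inf_joinr d (B : ctbDistrLatticeType d) (u : nat -> B) (x y : B) :
  infimums (range u) x ->
  infimums (range (fun n => u n `|` y)%O) (x `|` y)%O.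
Proof.
rewrite !infimums_seqP => -[ux glb]; split=> [n|z uz]; first exact: leU2.
by rewrite joinC -leBLR; apply: glb => n; rewrite leBLR joinC.
Qed.

(** Limits of monotone sequences are unique, so monotone classes can be
    intersected. Some M0 must be given: the intersection of an empty family is
    the whole algebra, in which monotone sequences need not have limits. *)
Lemma smallest_monotone_class d (B : ctbDistrLatticeType d) (G M0 : set B) :
  monotone_class M0 -> G `<=` M0 -> monotone_class (smallest (@monotone_class d B) G).
Proof.
move=> mM0 GM0; split=> u Mu umon.
  have [x _ xsup] := mM0.1 u (fun n => Mu n _ (conj mM0 GM0)) umon.
  exists x => // M [mM GM].
  have [y My ysup] := mM.1 u (fun n => Mu n _ (conj mM GM)) umon.
  by rewrite (is_subset1_supremums xsup ysup).
have [x _ xinf] := mM0.2 u (fun n => Mu n _ (conj mM0 GM0)) umon.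
exists x => // M [mM GM].
have [y My yinf] := mM.2 u (fun n => Mu n _ (conj mM GM)) umon.
by rewrite (is_subset1_infimums xinf yinf).
Qed.

(** The elements of a monotone class whose complement is also in it form a
    monotone class, as complementation exchanges suprema and infima. *)
Lemma smallest_monotone_compl d (B : ctbDistrLatticeType d) (G M0 : set B) :
  monotone_class M0 -> G `<=` M0 -> (forall x, G x -> G (~` x)%O) ->
  forall x, smallest (@monotone_class d B) G x ->
            smallest (@monotone_class d B) G (~` x)%O.
Proof.
move=> mM0 GM0 GC; set M := smallest _ G.
have mM : monotone_class M by exact: smallest_monotone_class mM0 GM0.
suff mK : monotone_class [set x | M x /\ M (~` x)%O].
  have GK : G `<=` [set x | M x /\ M (~` x)%O].
    by move=> x Gx; split; apply: sub_gen_smallest => //; exact: GC.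
  by move=> x /(_ _ (conj mK GK))[].
split=> u Ku umon.
- have [x Mx xsup] := mM.1 u (fun n => (Ku n).1) umon.
  have [y My yinf] := mM.2 _ (fun n => (Ku n).2) (nonincreasing_compl umon).
  exists x => //; split=> //; move/sup_compl: (xsup) => xinf.
  by rewrite (is_subset1_infimums xinf yinf).
- have [x Mx xinf] := mM.2 u (fun n => (Ku n).1) umon.
  have [y My ysup] := mM.1 _ (fun n => (Ku n).2) (nondecreasing_compl umon).
  exists x => //; split=> //; move/inf_compl: (xinf) => xsup.
  by rewrite (is_subset1_supremums xsup ysup).
Qed.

(** For fixed y, the elements whose join with y is in the class form a monotone
    class. That it contains G is clear for y in G, and then follows for every y
    by exchanging the roles of the two arguments. *)
Lemma smallest_monotone_join d (B : ctbDistrLatticeType d) (G M0 : set B) :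
  monotone_class M0 -> G `<=` M0 -> (forall x y, G x -> G y -> G (x `|` y)%O) ->
  forall x y, smallest (@monotone_class d B) G x ->
    smallest (@monotone_class d B) G y ->
    smallest (@monotone_class d B) G (x `|` y)%O.
Proof.
move=> mM0 GM0 GU; set M := smallest _ G.
have mM : monotone_class M by exact: smallest_monotone_class mM0 GM0.
have GM : G `<=` M by exact: sub_gen_smallest.
have mK y : monotone_class [set x | M x /\ M (x `|` y)%O].
  split=> u Ku umon.
  - have [x Mx xsup] := mM.1 u (fun n => (Ku n).1) umon.
    have uy : nondecreasing_seq (fun n => u n `|` y)%O.
      by move=> m n mn; rewrite leU2 ?umon.
    have [z Mz zsup] := mM.1 _ (fun n => (Ku n).2) uy.
    exists x => //; split=> //; have xysup := sup_joinr y xsup.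
    by rewrite (is_subset1_supremums xysup zsup).
  - have [x Mx xinf] := mM.2 u (fun n => (Ku n).1) umon.
    have uy : nonincreasing_seq (fun n => u n `|` y)%O.
      by move=> m n mn; rewrite leU2 ?umon.
    have [z Mz zinf] := mM.2 _ (fun n => (Ku n).2) uy.
    exists x => //; split=> //; have xyinf := inf_joinr y xinf.
    by rewrite (is_subset1_infimums xyinf zinf).
have MG x y : M x -> G y -> M (x `|` y)%O.
  move=> Mx Gy; suff GK : G `<=` [set x | M x /\ M (x `|` y)%O].
    by have [] := Mx _ (conj (mK y) GK).
  by move=> z Gz; split; apply: GM => //; exact: GU.
move=> x y Mx My; suff GK : G `<=` [set x | M x /\ M (x `|` y)%O].
  by have [] := Mx _ (conj (mK y) GK).
by move=> z Gz; split; [exact: GM|rewrite joinC; exact: MG].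
Qed.

(** * Asymptotic density *)

Lemma density_cvg (R : realType) (A : set posnat) (a : R) :
  freq R A @ \oo --> a <-> has_density R A /\ nu R A = a.
Proof.
split=> [Aa|[cA <-]//]; split; last exact/cvg_lim.
by apply/cvg_ex; exists a.
Qed.

Lemma cvg_density (R : realType) (A : set posnat) :
  has_density R A -> freq R A @ \oo --> nu R A.
Proof. by move=> dA; apply/density_cvg. Qed.

Lemma freq_le_upto (R : realType) (A B : set posnat) N :
  (forall x, A x -> (sval x <= N)%N -> B x) -> freq R A N <= freq R B N.
Proof.
move=> AB; rewrite ler_wpM2l ?invr_ge0//; apply: ler_sum_nat => n /andP[_ nN].
rewrite !indicE ler_nat.
case: (boolP (n \in _)) => //= /set_mem[x Ax xn].
by rewrite mem_set//; exists x => //; apply: AB => //; rewrite xn.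
Qed.

Lemma freqT (R : realType) N : (0 < N)%N -> freq R setT N = 1.
Proof.
move=> N0; rewrite /freq (eq_big_nat _ _ (F2 := fun=> 1)) => [|n /andP[n0 _]].
  by rewrite sumr_const_nat subSS subn0 mulVf// pnatr_eq0 -lt0n.
by rewrite indicE mem_set//; exists (exist _ n n0).
Qed.

Lemma freqUI (R : realType) (A B : set posnat) N :
  A `&` B = set0 -> freq R (A `|` B) N = freq R A N + freq R B N.
Proof.
move=> AB0; rewrite /freq -mulrDr -big_split/=; congr (_ * _).
apply: eq_bigr => n _; rewrite image_setU !indicE in_setU.
case: (boolP (n \in sval @` A)) => [/set_mem[x Ax xn]|_]; last by rewrite add0r.
case: (boolP (n \in sval @` B)) => [/set_mem[y By yn]|_]; last by rewrite addr0.
suff : (A `&` B) x by rewrite AB0.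
by split=> //; rewrite (_ : x = y)//; apply: val_inj; rewrite /= xn yn.
Qed.

Lemma freqD (R : realType) (A B : set posnat) N :
  freq R (B `\` A) N = freq R B N - freq R A N + freq R (A `\` B) N.
Proof.
have -> : freq R B N = freq R (A `&` B) N + freq R (B `\` A) N.
  rewrite -freqUI; last by apply/seteqP; split=> x /=; tauto.
  by congr (freq _ _ _); apply/seteqP; split=> x /=; have := EM (A x); tauto.
have -> : freq R A N = freq R (A `&` B) N + freq R (A `\` B) N.
  rewrite -freqUI; last by apply/seteqP; split=> x /=; tauto.
  by congr (freq _ _ _); apply/seteqP; split=> x /=; have := EM (B x); tauto.
by lra.
Qed.

Lemma freqY (R : realType) (A B : set posnat) N :
  freq R (A `+` B) N =
  freq R B N - freq R A N + (freq R (A `\` B) N + freq R (A `\` B) N).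
Proof.
rewrite freqUI; first by rewrite (freqD _ A B); lra.
by apply/seteqP; split=> x /=; tauto.
Qed.

Lemma nu_null_near (R : realType) (A : set posnat) :
  (forall e : R, 0 < e -> \forall N \near \oo, freq R A N <= e) -> nu_null R A.
Proof.
move=> Ae; apply/nu_nullP/cvgrPdist_le => e e0.
by near=> N; rewrite sub0r normrN ger0_norm ?freq_ge0//; near: N; exact: Ae.
Unshelve. all: by end_near. Qed.

Lemma nu_null_initial (R : realType) m : nu_null R [set x | (sval x < m)%N].
Proof.
apply: nu_null_near => e e0.
have le_m N : freq R [set x | (sval x < m)%N] N <= m%:R / N%:R.
  rewrite mulrC ler_wpM2l ?invr_ge0//.
  apply: (@le_trans _ _ (\sum_(1 <= n < N.+1) (n < m)%N%:R)).
    apply: ler_sum => n _; rewrite indicE ler_nat.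
    by case: (boolP (n \in _)) => [/set_mem[x /= xm <-]|_]; rewrite ?xm.
  rewrite -natr_sum ler_nat; apply: (@leq_trans (minn N m)); last exact: geq_minr.
  elim: N => [|N IH]; first by rewrite big_geq.
  by rewrite big_nat_recr//=; lia.
near=> N; apply: le_trans (le_m N) _.
rewrite ler_pdivrMr; last by rewrite ltr0n; near: N; exists 1%N.
rewrite mulrC -ler_pdivrMr//; near: N; exact: nbhs_infty_ger.
Unshelve. all: by end_near. Qed.

Lemma nu_null_setD (R : realType) (A B : set posnat) :
  A `<=` B -> nu_null R (A `\` B).
Proof. by rewrite -setD_eq0 => ->; exact: nu_null0. Qed.

Lemma densityT (R : realType) : freq R setT @ \oo --> (1 : R).
Proof.
apply: (@squeeze_cvgr _ _ _ _ (fun=> 1) (fun=> 1)).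
- by near=> N; rewrite freqT ?lexx//; near: N; exists 1%N.
- exact: cvg_cst.
- exact: cvg_cst.
Unshelve. all: by end_near. Qed.

(** Here and below A is contained in B up to a null set only, as is the case for
    representatives of comparable classes. *)
Lemma densityD (R : realType) (A B : set posnat) (a b : R) : nu_null R (A `\` B) ->
  freq R A @ \oo --> a -> freq R B @ \oo --> b ->
  freq R (B `\` A) @ \oo --> b - a.
Proof.
move=> /nu_nullP A0 Aa Bb; rewrite (funext (freqD R A B)) -[X in _ --> X]addr0.
by apply: cvgD A0; exact: cvgB.
Qed.

Lemma densityC (R : realType) (A : set posnat) (a : R) :
  freq R A @ \oo --> a -> freq R (~` A) @ \oo --> 1 - a.
Proof.
move=> Aa; rewrite -setTD; apply: densityD => //; last exact: densityT.
exact: nu_null_setD.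
Qed.

Lemma densityY (R : realType) (A B : set posnat) (a b : R) : nu_null R (A `\` B) ->
  freq R A @ \oo --> a -> freq R B @ \oo --> b ->
  freq R (A `+` B) @ \oo --> b - a.
Proof.
move=> /nu_nullP A0 Aa Bb; rewrite (funext (freqY R A B)) -[X in _ --> X]addr0.
by apply: cvgD; [exact: cvgB|rewrite -[X in _ --> X]addr0; exact: cvgD].
Qed.

Lemma nuC (R : realType) (A : set posnat) : has_density R A ->
  has_density R (~` A) /\ nu R (~` A) = 1 - nu R A.
Proof. by move=> /cvg_density/densityC/density_cvg. Qed.

Lemma density_cls (R : realType) (A B : set posnat) (a : R) :
  cls R A = cls R B -> freq R A @ \oo --> a -> freq R B @ \oo --> a.
Proof.
move=> /clsP AB Aa.
have A0 : nu_null R (A `\` B) by apply: nu_null_sub AB => x; left.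
have B0 : nu_null R (B `\` A) by apply: nu_null_sub AB => x; right.
move: A0 B0 => /nu_nullP A0 /nu_nullP B0.
rewrite (_ : freq R B = fun N => freq R A N + freq R (B `\` A) N - freq R (A `\` B) N).
  by rewrite -[X in _ --> X]subr0 -[X in _ --> X - _]addr0; apply: cvgB A0; exact: cvgD.
by apply/funext => N; rewrite freqD; lra.
Qed.

Lemma nu_le (R : realType) (A B : set posnat) : has_density R A ->
  has_density R B -> A `<=` B -> nu R A <= nu R B.
Proof.
by move=> dA dB AB; apply: ler_lim => //; near=> N; exact: freq_subset.
Unshelve. all: by end_near. Qed.

Lemma nuY_triangle (R : realType) (A B C : set posnat) :
  has_density R (A `+` B) -> has_density R (B `+` C) ->
  has_density R (A `+` C) ->
  nu R (A `+` C) <= nu R (A `+` B) + nu R (B `+` C).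
Proof.
move=> dAB dBC dAC.
apply: (ler_cvg_to (cvg_density dAC) (cvgD (cvg_density dAB) (cvg_density dBC))).
near=> N; apply: le_trans (freqU _ _ _ _); apply: freq_subset => x /=.
by have := EM (B x); tauto.
Unshelve. all: by end_near. Qed.

Lemma cls_setU (R : realType) (A B : set posnat) :
  cls R (A `|` B) = (cls R A `|` cls R B)%O.
Proof. exact/esym/qjoinE. Qed.

Lemma cls_setC (R : realType) (A : set posnat) : cls R (~` A) = (~` cls R A)%O.
Proof. exact/esym/qcomplE. Qed.

(** * Suprema of sets with density *)

(** An upper bound Y contains A n up to a null set, so what it misses of X is, up
    to a null set, in X `\` A n, whose density x - a n tends to 0. *)
Lemma density_supremum (R : realType) (A : nat -> set posnat) (X : set posnat)
    (a : nat -> R) (x : R) :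
  (forall n, freq R (A n) @ \oo --> a n) -> freq R X @ \oo --> x ->
  a @ \oo --> x -> (forall n, nu_null R (A n `\` X)) ->
  supremums (range (fun n => cls R (A n))) (cls R X).
Proof.
move=> Aa Xx ax AX; apply/supremums_seqP; split=> [n|y]; first exact/cls_le.
rewrite -(clsK y); set Y := repr y => AY; apply/cls_le/nu_null_near => e e0.
have e2 : 0 < e / 2 by lra.
have [n xan] : exists n, x - a n < e / 2.
  move/cvgrPdist_lt : ax => /(_ _ e2)[n _ /(_ n (leqnn n))]/= xan.
  by exists n; exact: le_lt_trans (ler_norm _) xan.
have XA := densityD (AX n) (Aa n) Xx.
have /cls_le/nu_nullP AYn := AY n.
have /cvgrPdist_le/(_ _ e2) near_sum :
    freq R (X `\` A n) \+ freq R (A n `\` Y) @ \oo --> x - a n.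
  by rewrite -[x - a n]addr0; exact: cvgD.
near=> N; apply: (@le_trans _ _ (freq R (X `\` A n) N + freq R (A n `\` Y) N)).
  apply: le_trans (freqU _ _ _ _); apply: freq_subset => z /=.
  by have := EM (A n z); tauto.
have : `|x - a n - (freq R (X `\` A n) N + freq R (A n `\` Y) N)| <= e / 2.
  by near: N.
by rewrite ler_norml; lra.
Unshelve. all: by end_near. Qed.

(** Each A n enters X only from the rank g n on, where its frequencies exceed
    its density by at most n.+1%:R^-1. Hence X contains A n up to finitely many
    points, while up to N it lies in A K for the largest K with g K <= N, whose
    frequency at N is under control. *)
Lemma density_diagonal (R : realType) (A : nat -> set posnat) :
  (forall n, has_density R (A n)) -> nondecreasing_seq A ->
  exists X, [/\ has_density R X, forall n, nu_null R (A n `\` X) &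
                (fun n => nu R (A n)) @ \oo --> nu R X].
Proof.
move=> dA And.
have sA m n : (m <= n)%N -> A m `<=` A n by move=> /And /subsetPset.
pose a n := nu R (A n).
have and : nondecreasing_seq a by move=> m n /sA; exact: nu_le.
have ac : cvg (a @ \oo).
  apply: nondecreasing_is_cvgn => //; exists (nu R setT) => _ [n _ <-].
  by apply: nu_le => //; have /density_cvg[] := @densityT R.
set x := lim (a @ \oo) in ac *.
have ax n : a n <= x by exact: nondecreasing_cvgn_le.
have [f Af] : exists f : nat -> nat, forall n N, (f n <= N)%N ->
    freq R (A n) N <= a n + n.+1%:R^-1.
  suff /choice[f Af] : forall n, exists m, forall N, (m <= N)%N ->
    freq R (A n) N <= a n + n.+1%:R^-1 by exists f.
  move=> n; have n0 : 0 < n.+1%:R^-1 :> R by rewrite invr_gt0 ltr0n.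
  have /cvgrPdist_le/(_ _ n0)[m _ Am] := cvg_density (dA n).
  by exists m => N /Am/=; rewrite ler_distlC /a => /andP[_].
pose g n := (f n + n)%N.
pose X := [set z : posnat | exists2 n, A n z & (g n <= sval z)%N].
have AX n : nu_null R (A n `\` X).
  apply: nu_null_sub (nu_null_initial R (g n)) => z /= [Az Xz].
  by rewrite ltnNge; apply/negP => gz; apply: Xz; exists n.
suff Xx : freq R X @ \oo --> x.
  by exists X; move/density_cvg : (Xx) => [dX ->].
apply/cvgrPdist_le => e e0; have e2 : 0 < e / 2 by lra.
have [n xan] : exists n, x - a n < e / 2.
  move/cvgrPdist_lt : ac => /(_ _ e2)[n _ /(_ n (leqnn n))]/= xan.
  by exists n; exact: le_lt_trans (ler_norm _) xan.
have [k ke] : exists k : nat, k.+1%:R^-1 < e.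
  by have [k _ /(_ k (leqnn k))] := near_infty_natSinv_lt (PosNum e0); exists k.
have /nu_nullP AXn := AX n.
have /cvgrPdist_le/(_ _ e2) near_diff :
    freq R (A n) \- freq R (A n `\` X) @ \oo --> a n.
  by rewrite -[a n]subr0; exact: cvgB (cvg_density (dA n)) AXn.
near=> N; rewrite ler_distlC; apply/andP; split.
  have : `|a n - (freq R (A n) N - freq R (A n `\` X) N)| <= e / 2 by near: N.
  have := freqD R (A n) X N; have := freq_ge0 R (X `\` A n) N.
  by rewrite ler_norml; lra.
have kN : (g k <= N)%N by near: N; exact: nbhs_infty_ge.
have gN m : (g m <= N)%N -> (m <= N)%N by rewrite /g; lia.
have [K KN Kmax] := ex_maxnP (ex_intro _ k kN) gN.
apply: (@le_trans _ _ (freq R (A K) N)).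
  apply: freq_le_upto => z [m Amz gz] zN.
  by apply: (sA m K) => //; apply: Kmax; exact: leq_trans gz zN.
apply: (@le_trans _ _ (a K + K.+1%:R^-1)).
  by apply: Af; apply: leq_trans KN; rewrite /g leq_addr.
rewrite lerD// (le_trans _ (ltW ke))// lef_pV2 ?posrE ?ltr0n// ler_nat ltnS.
exact: Kmax.
Unshelve. all: by end_near. Qed.

Lemma cls_bigsetU_nondecreasing (R : realType) (A : nat -> set posnat) n :
  nondecreasing_seq (fun n => cls R (A n)) ->
  cls R (\big[setU/set0]_(i < n.+1) A i) = cls R (A n).
Proof.
move=> And; elim: n => [|n IH]; first by rewrite big_ord_recr big_ord0/= set0U.
by rewrite big_ord_recr/= cls_setU IH; apply/join_r/And.
Qed.

(** Representatives of a non-decreasing sequence of classes are nested only up to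
    null sets; their finite unions are nested and have the same classes. *)
Lemma has_density_sup (R : realType) (A : nat -> set posnat) :
  (forall n, has_density R (A n)) -> nondecreasing_seq (fun n => cls R (A n)) ->
  exists X, [/\ has_density R X,
                supremums (range (fun n => cls R (A n))) (cls R X) &
                (fun n => nu R (A n)) @ \oo --> nu R X].
Proof.
move=> dA And; pose B n := \big[setU/set0]_(i < n.+1) A i.
have BA n : cls R (B n) = cls R (A n) by exact: cls_bigsetU_nondecreasing.
have Ba n : freq R (B n) @ \oo --> nu R (A n).
  exact: density_cls (esym (BA n)) (cvg_density (dA n)).
have [n||X [dX BX Bx]] := @density_diagonal R B.
- by case/density_cvg : (Ba n).
- by move=> m n mn; apply/subsetPset; exact: subset_bigsetU.
have eB : (fun n => nu R (B n)) = (fun n => nu R (A n)).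
  by apply/funext => n; case/density_cvg : (Ba n).
rewrite {}eB in Bx; exists X; split=> //.
rewrite (_ : (fun n => cls R (A n)) = (fun n => cls R (B n))); last exact/funext.
exact: density_supremum Ba (cvg_density dX) Bx BX.
Qed.

(** A supremum is unique as a class, so the continuity found for one
    representative holds for all. *)
Lemma nu_sup (R : realType) (A : nat -> set posnat) (X : set posnat) :
  (forall n, has_density R (A n)) -> has_density R X ->
  nondecreasing_seq (fun n => cls R (A n)) ->
  supremums (range (fun n => cls R (A n))) (cls R X) ->
  (fun n => nu R (A n)) @ \oo --> nu R X.
Proof.
move=> dA dX And Xsup; have [Y [dY Ysup]] := has_density_sup dA And.
have YX := is_subset1_supremums Ysup Xsup.
by have /density_cvg[_ ->] := density_cls YX (cvg_density dY).
Qed.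

Lemma nu_inf (R : realType) (A : nat -> set posnat) (X : set posnat) :
  (forall n, has_density R (A n)) -> has_density R X ->
  nonincreasing_seq (fun n => cls R (A n)) ->
  infimums (range (fun n => cls R (A n))) (cls R X) ->
  (fun n => nu R (A n)) @ \oo --> nu R X.
Proof.
move=> dA dX Ani /inf_compl Xinf.
have eC : (fun n => cls R (~` A n)) = (fun n => ~` cls R (A n))%O.
  by apply/funext => n; exact: cls_setC.
have := @nu_sup R (fun n => ~` A n) (~` X).
rewrite eC cls_setC (nuC dX).2 => cC.
have {}cC := cC (fun n => (nuC (dA n)).1) (nuC dX).1 (nondecreasing_compl Ani) Xinf.
have -> : nu R X = 1 - (1 - nu R X) by lra.
have -> : (fun n => nu R (A n)) = (fun=> 1) \- (fun n => nu R (~` A n)).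
  by apply/funext => n /=; rewrite (nuC (dA n)).2; lra.
by apply: cvgB cC; exact: cvg_cst.
Qed.

Lemma clss_seq (R : realType) (C : set (set posnat))
    (u : nat -> posnat_mod_null R) : (forall n, clss R C (u n)) ->
  exists2 A : nat -> set posnat, forall n, C (A n) & u = fun n => cls R (A n).
Proof.
move=> Cu; have /choice[A CA] n : exists X, C X /\ cls R X = u n.
  by have [X CX Xu] := Cu n; exists X.
by exists A => [n|]; [case: (CA n)|apply/funext => n; case: (CA n)].
Qed.

Lemma monotone_class_has_density (R : realType) :
  monotone_class (clss R (has_density R)).
Proof.
split=> u /clss_seq[A dA ->] mon.
  by have [X [dX Xsup _]] := has_density_sup dA mon; exists (cls R X) => //; exists X.
have eC : (fun n => cls R (~` A n)) = (fun n => ~` cls R (A n))%O.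
  by apply/funext => n; exact: cls_setC.
have [n||X [dX]] := @has_density_sup R (fun n => ~` A n).
- by have [] := nuC (dA n).
- by rewrite eC; exact: nondecreasing_compl.
rewrite eC -(setCK X) cls_setC => /inf_compl Xinf _.
by exists (cls R (~` X)) => //; exists (~` X) => //; have [] := nuC dX.
Qed.

Lemma clss_sub (R : realType) (C D : set (set posnat)) :
  C `<=` D -> clss R C `<=` clss R D.
Proof. exact: image_subset. Qed.

Lemma monotone_class_sigma_cls (R : realType) (D : set (set posnat)) :
  D `<=` has_density R -> monotone_class (sigma_cls R D).
Proof.
move=> /(@clss_sub R) dD.
exact: smallest_monotone_class (monotone_class_has_density R) dD.
Qed.

(** * Approximation in density *)

(** The sets of A within any positive density of D form, modulo null sets, a
    monotone class, since nu is continuous along monotone sequences of [A]. *)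
Lemma sigma_cls_dense (R : realType) (A D : set (set posnat)) :
  A `<=` has_density R -> set_field A -> D `<=` A ->
  clss R A = sigma_cls R D ->
  forall X (e : R), A X -> 0 < e -> exists2 B, D B & nu R (X `+` B) < e.
Proof.
move=> dA Af DA AD.
have mA : monotone_class (clss R A).
  by rewrite AD; apply: monotone_class_sigma_cls => X /DA/dA.
have AY X Y : A X -> A Y -> has_density R (X `+` Y).
  by move=> AX AY; apply: dA; exact: set_fieldY.
pose M := [set X | A X /\
  forall e : R, 0 < e -> exists2 B, D B & nu R (X `+` B) < e].
have limM (X : nat -> set posnat) Y : (forall n, M (X n)) -> A Y ->
    (forall e : R, 0 < e -> exists n, nu R (Y `+` X n) < e) -> M Y.
  move=> MX AY' YX; split=> // e e0; have e2 : 0 < e / 2 by lra.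
  have [n Yn] := YX _ e2; have [AXn /(_ _ e2)[B DB nB]] := MX n.
  exists B => //; have AB := DA _ DB.
  apply: le_lt_trans (nuY_triangle (AY _ _ AY' AXn) (AY _ _ AXn AB) (AY _ _ AY' AB)) _.
  by lra.
have mM : monotone_class (clss R M).
  split=> u /clss_seq[X MX ->] mon; have AX n : A (X n) by have [] := MX n.
  - have clsAX n : clss R A (cls R (X n)) by exists (X n).
    have [_ [Y AY' <-] Ysup] := mA.1 _ clsAX mon.
    exists (cls R Y) => //; exists Y => //; apply: (limM X) => // e e0.
    have dAX n : has_density R (X n) by exact: dA.
    have /cvgrPdist_lt/(_ _ e0)[n _ /(_ n (leqnn n))/= Yn] :=
      nu_sup dAX (dA _ AY') mon Ysup.
    exists n; rewrite setYC.
    have /supremums_seqP[/(_ n)/cls_le XY _] := Ysup.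
    have /density_cvg[_ ->] :=
      densityY XY (cvg_density (dAX n)) (cvg_density (dA _ AY')).
    exact: le_lt_trans (ler_norm _) Yn.
  - have clsAX n : clss R A (cls R (X n)) by exists (X n).
    have [_ [Y AY' <-] Yinf] := mA.2 _ clsAX mon.
    exists (cls R Y) => //; exists Y => //; apply: (limM X) => // e e0.
    have dAX n : has_density R (X n) by exact: dA.
    have /cvgrPdist_lt/(_ _ e0)[n _ /(_ n (leqnn n))/= Yn] :=
      nu_inf dAX (dA _ AY') mon Yinf.
    exists n.
    have /infimums_seqP[/(_ n)/cls_le YX _] := Yinf.
    have /density_cvg[_ ->] :=
      densityY YX (cvg_density (dA _ AY')) (cvg_density (dAX n)).
    by apply: le_lt_trans Yn; rewrite distrC; exact: ler_norm.
have DM : clss R D `<=` clss R M.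
  apply: clss_sub => X DX; split=> [|e e0]; first exact: DA.
  exists X => //; rewrite setYK.
  by have [_ ->] := nu_null0 R.
move=> X e AX e0.
have [Z [AZ /(_ _ e0)[B DB ZB]] ZX] : clss R M (cls R X).
  suff : clss R A `<=` clss R M by apply; exists X.
  by rewrite AD => x; apply.
exists B => //; apply: le_lt_trans ZB.
have AB := DA _ DB.
apply: le_trans (nuY_triangle (AY _ _ AX AZ) (AY _ _ AZ AB) (AY _ _ AX AB)) _.
by have /esym/clsP[_ ->] := ZX; rewrite add0r.
Qed.

(** The finite unions of ever better approximations are a non-decreasing sequence
    in D whose densities tend to that of X. *)
Lemma sigma_cls_of_subsets (R : realType) (D : set (set posnat)) X :
  D `<=` has_density R -> set_field D -> has_density R X ->
  (forall e : R, 0 < e -> exists2 B, D B & B `<=` X /\ nu R X - nu R B < e) ->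
  sigma_cls R D (cls R X).
Proof.
move=> dD Df dX DX; have [_ _ DU] := Df.
have [B DB BX] : exists2 B : nat -> set posnat, forall n, D (B n) &
    forall n, B n `<=` X /\ nu R X - nu R (B n) < n.+1%:R^-1.
  suff /choice[B DB] : forall n, exists B,
      D B /\ B `<=` X /\ nu R X - nu R B < n.+1%:R^-1.
    by exists B => n; have [] := DB n.
  move=> n; have n0 : 0 < n.+1%:R^-1 :> R by rewrite invr_gt0 ltr0n.
  by have [B DB BX] := DX _ n0; exists B.
pose W n := \big[setU/set0]_(i < n.+1) B i.
have DW n : D (W n).
  by apply: (big_ind D) => [|Y Z|i _]; [exact: set_field0|exact: DU|exact: DB].
have WX n : W n `<=` X.
  apply: (big_ind (fun Y => Y `<=` X)) => [|Y Z YX ZX|i _].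
  - exact: sub0set.
  - by rewrite subUset.
  - by case: (BX i).
have BW n : B n `<=` W n by rewrite /W big_ord_recr/=; exact: subsetUr.
have Wnd : nondecreasing_seq (fun n => cls R (W n)).
  move=> m n mn; apply/cls_le/nu_null_setD.
  exact: subset_bigsetU.
have WnuX : (fun n => nu R (W n)) @ \oo --> nu R X.
  apply/cvgrPdist_lt => e e0; near=> n.
  have WnX : nu R (W n) <= nu R X by apply: nu_le => //; exact: dD.
  rewrite ger0_norm ?subr_ge0//.
  have BnW : nu R (B n) <= nu R (W n) by apply: nu_le => //; exact: dD.
  have [_ Bn] := BX n; apply: (@le_lt_trans _ _ (nu R X - nu R (B n))).
    by rewrite lerD2l lerN2.
  apply: lt_trans Bn _; near: n; exact: near_infty_natSinv_lt (PosNum e0).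
have sW n : sigma_cls R D (cls R (W n)) by apply: sub_gen_smallest; exists (W n).
have [x sx xsup] := (monotone_class_sigma_cls dD).1 _ sW Wnd.
rewrite (_ : cls R X = x)//; apply: is_subset1_supremums xsup.
apply: density_supremum WnuX _ => [n||n]; first exact/cvg_density/dD.
  exact: cvg_density.
exact: nu_null_setD.
Unshelve. all: by end_near. Qed.

(** * Chains and countable sets of generators *)

(** The monotone class theorem for the quotient, read on representatives. *)
Lemma sigma_cls_field (R : realType) (D : set (set posnat)) :
  D `<=` has_density R -> set_field D -> set_field [set X | sigma_cls R D (cls R X)].
Proof.
move=> dD [DT DC DU].
have mF := monotone_class_has_density R; have FD := clss_sub (R := R) dD.
split=> [|X|X Y].
- by apply: sub_gen_smallest; exists setT.
- rewrite /= cls_setC; apply: smallest_monotone_compl mF FD _ _.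
  by move=> _ [Z DZ <-]; exists (~` Z); [exact: DC|exact: cls_setC].
- rewrite /= cls_setU; apply: smallest_monotone_join mF FD _ _ _.
  move=> _ _ [Z DZ <-] [W DW <-].
  by exists (Z `|` W); [exact: DU|exact: cls_setU].
Qed.

(** A subset of the line has a countable dense subset; here the values of f
    play the role of the points. *)
Lemma countable_dense_values (R : realType) T (P : set T) (f : T -> R) :
  exists C : set T, [/\ C `<=` P, countable C &
    forall x (e : R), P x -> 0 < e -> exists2 c, C c & `|f x - f c| < e].
Proof.
pose I (pq : rat * rat) := [set x | P x /\ ratr pq.1 < f x < ratr pq.2].
have /choice[g gI] pq : exists C : set T,
    [/\ C `<=` P, countable C & I pq !=set0 -> C `&` I pq !=set0].
  have [[x [Px fx]]|I0] := pselect (I pq !=set0); last by exists set0; split.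
  exists [set x]; split=> [_ ->//||_]; first exact: countable1.
  by exists x.
exists (\bigcup_pq g pq); split.
- by move=> x [pq _]; have [gP _ _] := gI pq; exact: gP.
- by apply: bigcup_countable => // pq _; have [] := gI pq.
- move=> x e Px e0.
  (* an interval around f x with rational ends, shorter than e on each side *)
  have [p /andP[xp px]] : exists p : rat, f x - e / 2 < ratr p < f x.
    by have [|p] := @rat_in_itvoo R (f x - e / 2) (f x); [lra|rewrite in_itv; exists p].
  have [q /andP[xq qx]] : exists q : rat, f x < ratr q < f x + e / 2.
    by have [|q] := @rat_in_itvoo R (f x) (f x + e / 2); [lra|rewrite in_itv; exists q].
  have [_ _] := gI (p, q); case.
    by exists x; split=> //=; rewrite px xq.
  move=> c [gc [_ /andP[/= pc cq]]]; exists c; first by exists (p, q).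
  by rewrite ltr_norml; lra.
Qed.

(** Since a set X of T is comparable with the elements of C, nearness of the
    densities means a symmetric difference of small density. If for some e0 no
    element of C below X is e0-close to X, then all that are e0-close lie above X,
    and the complement of X is approximated from below. *)
Lemma chain_sigma_cls (R : realType) (A C T : set (set posnat)) :
  A `<=` has_density R -> set_field A -> T `<=` A -> set_chain T -> C `<=` T ->
  (forall t (e : R), T t -> 0 < e -> exists2 c, C c & `|nu R t - nu R c| < e) ->
  sigma_cls R (field_gen C) = sigma_cls R (field_gen T).
Proof.
move=> dA Af TA Tch CT dense.
have genCA : field_gen C `<=` A by apply: field_gen_sub => // X /CT/TA.
have genCF : field_gen C `<=` has_density R by move=> X /genCA/dA.
have genTF : field_gen T `<=` has_density R by move=> X /(field_gen_sub Af TA)/dA.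
have genf := field_gen_field C; have [_ genC _] := genf.
have sf := sigma_cls_field genCF genf; have [_ sC _] := sf.
apply/seteqP; split.
  apply: smallest_sub; first exact: monotone_class_sigma_cls.
  move=> _ [X CX <-]; apply: sub_gen_smallest; exists X => //.
  apply: field_gen_sub CX; first exact: field_gen_field.
  by move=> Y /CT TY; exact: sub_gen_smallest.
apply: smallest_sub; first exact: monotone_class_sigma_cls.
move=> _ [X TX <-].
apply: (field_gen_sub sf) TX => {}X TX /=.
have dX := dA _ (TA _ TX).
have [below|] := pselect (forall e : R, 0 < e ->
    exists2 c, C c & c `<=` X /\ nu R X - nu R c < e).
  apply: sigma_cls_of_subsets => // e /below[c Cc cX].
  by exists c => //; exact: sub_gen_smallest.
move=> /existsNP[e0 /not_implyP[e0_gt0 no_below]].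
rewrite -(setCK X); apply: sC.
apply: sigma_cls_of_subsets => //; first by have [] := nuC dX.
move=> e e_gt0; have [|c Cc cX] := dense X (Num.min e e0) TX.
  by rewrite lt_min e_gt0.
exists (~` c); first by apply: genC; exact: sub_gen_smallest.
have dc := dA _ (TA _ (CT _ Cc)).
rewrite (nuC dX).2 (nuC dc).2.
move: cX; rewrite lt_min => /andP[cXe cXe0].
have [Xc|cX] := Tch _ _ TX (CT _ Cc).
  split; first exact: subsetC.
  by move: cXe; rewrite ltr_norml; lra.
case: no_below; exists c => //; split=> //.
exact: le_lt_trans (ler_norm _) cXe0.
Qed.

Theorem theorem10p3 (R : realType) (A : set (set posnat))
    (A_sub : A `<=` has_density R) (A_field : set_field A) :
  ((exists T : set (set posnat),
      [/\ T `<=` A, set_chain T & clss R A = sigma_cls R (field_gen T)])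
   <->
   (exists C : set (set posnat),
      [/\ C `<=` A, countable C & clss R A = sigma_cls R (field_gen C)]))
  /\
  ((exists T : set (set posnat),
      [/\ T `<=` A, set_chain T & clss R A = sigma_cls R (field_gen T)])
   \/
   (exists C : set (set posnat),
      [/\ C `<=` A, countable C & clss R A = sigma_cls R (field_gen C)])
   -> nu_separable R A).
Proof.
have chain_countable : (exists T : set (set posnat),
      [/\ T `<=` A, set_chain T & clss R A = sigma_cls R (field_gen T)]) ->
    exists C : set (set posnat),
      [/\ C `<=` A, countable C & clss R A = sigma_cls R (field_gen C)].
  move=> [T [TA Tch AT]].
  have [C [CT Ccnt dense]] := countable_dense_values T (nu R).
  exists C; split=> //; first exact: subset_trans TA.
  by rewrite (chain_sigma_cls A_sub A_field TA Tch CT dense).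
split; first split=> // -[C [CA Ccnt AC]].
  have [L Lch LC] := countable_field_chain Ccnt.
  exists L; split=> //; last by rewrite LC.
  apply: subset_trans (field_gen_sub A_field CA); rewrite -LC.
  exact: sub_gen_smallest.
move=> hyp; have [C [CA Ccnt AC]] : exists C : set (set posnat),
    [/\ C `<=` A, countable C & clss R A = sigma_cls R (field_gen C)].
  by case: hyp.
have genCA := field_gen_sub A_field CA.
exists (field_gen C); split=> //; first exact: countable_field_gen.
exact: sigma_cls_dense.
Qed.
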